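(* Let $\alpha$ be an algebraic number all of whose conjugates lie on the unit circle. If $m(\alpha)\ge \deg(\alpha)/2-1$, or $m(\alpha)=1$, then $\alpha$ satisfies the height reducing property.
   Context: Conjugates and degree are over $\mathbb{Q}$. Complex numbers $\alpha_1,\dots,\alpha_m$ are multiplicatively independent if $\prod_{j=1}^m\alpha_j^{k_j}=1$ with $(k_1,\dots,k_m)\in\mathbb{Z}^m$ implies $k_1=\dots=k_m=0$. For an algebraic number $\alpha$, $m(\alpha)$ denotes the greatest number of conjugates of $\alpha$ which are multiplicatively independent. For $F\subset\mathbb{C}$, $F[\alpha]=\{\sum_{j=0}^{n}\varepsilon_j\alpha^j : n\in\mathbb{N},\ \varepsilon_j\in F\}$; $\alpha$ satisfies the height reducing property if there is a finite $F\subset\mathbb{Z}$ with $\mathbb{Z}[\alpha]=F[\alpha]$. *)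

(* Defs.v *)
From mathcomp Require Import all_boot all_order all_algebra all_field.
From mathcomp Require Import boolp classical_sets cardinality.

Set Implicit Arguments.
Unset Strict Implicit.
Unset Printing Implicit Defensive.

Import Order.TTheory GRing.Theory Num.Theory.

Local Open Scope classical_set_scope.
Local Open Scope ring_scope.

(* Every element of [algC] is algebraic over the rationals; [minCpoly a] is  *)
(* its monic minimal polynomial over them, with coefficients seen in [algC]. *)

Definition conjugate (a b : algC) : Prop := root (minCpoly a) b.

Definition degree (a : algC) : nat := (size (minCpoly a)).-1.

Definition mult_indep (m : nat) (x : 'I_m -> algC) : Prop :=
  forall k : 'I_m -> int, \prod_(j < m) x j ^ k j = 1 -> forall j, k j = 0.

(* An independent family of nonzero numbers has no repetition, and [a] has   *)
(* [degree a] conjugates, so for nonzero [a] the bound [n <= degree a] loses *)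
(* nothing.  The empty family is independent: roots of unity have rank 0.    *)
Definition mult_rank (a : algC) : nat :=
  \max_(n < (degree a).+1 |
      `[< exists x : 'I_n -> algC,
            (forall j, conjugate a (x j)) /\ mult_indep x >]) n.

Definition poly_values (F : set algC) (a : algC) : set algC :=
  [set z | exists (n : nat) (e : 'I_n.+1 -> algC),
     (forall j, F (e j)) /\ z = \sum_(j < n.+1) e j * a ^+ j].

Definition int_set : set algC := [set z | z \in Num.int].

Definition height_reducing (a : algC) : Prop :=
  exists F : set algC,
    [/\ finite_set F, F `<=` int_set & poly_values int_set a = poly_values F a].

(* Main.v *)
Require Import Defs.
From mathcomp Require Import all_boot all_order all_algebra all_field.
From mathcomp Require Import classical_sets cardinality zify ring.

Set Implicit Arguments.
Unset Strict Implicit.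
Unset Printing Implicit Defensive.

(* Let s be the conjugates of a, d their number and P an integer multiple of  *)
(* the minimal polynomial.  Peeling off d digits from R in Z[X] of degree     *)
(* < d gives R = E + R' X^d modulo P, where each coefficient of E may be      *)
(* chosen freely in its residue class modulo P(0).  Taking E as close as      *)
(* possible to M/n R, where n bounds N(R) = \sum_(z in s) |R(z)| and M is a   *)
(* large constant, makes |R'(z)| = |R(z) - E(z)| at most                      *)
(* (1 - M/n) |R(z)| + O(1) at every conjugate z, since |z| = 1; hence N(R')   *)
(* is at most n - 1.  The coefficients of E are bounded because those of R    *)
(* are bounded by a multiple of N(R), the conjugates being distinct.          *)

Import Order.TTheory GRing.Theory Num.Theory.

Local Open Scope ring_scope.

(** It suffices to find one bound [H] such that every integer polynomial has the same value at [a]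
    as one with coefficients at most [H] in absolute value. Dividing by [P] from the constant term
    upwards costs one digit of size at most [|P_0|] per step and lowers the degree until it is below
    [d]. On what remains, [digit_value_reduced] makes [N] descend: since all conjugates have modulus
    1, dividing by [X^d] preserves every [|R(z) - E(z)|], so one choice of [E] shrinks the sum over
    all conjugates. *)

Local Notation pZtoC := (map_poly (intr : int -> algC)).

(** Evaluation at distinct points is the Vandermonde matrix, which is invertible; [K] bounds the
    entries of its inverse. *)
Lemma coef_le_sum_horner (s : seq algC) : uniq s ->
  exists K : nat, forall p : {poly algC}, (size p <= size s)%N ->
    forall i, `|p`_i| <= K%:R * \sum_(z <- s) `|p.[z]|.
Proof.
move=> s_uniq; set n := size s.
pose x := \row_(j < n) s`_j; pose V := Vandermonde n x.
have V_unit : V \in unitmx.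
  rewrite unitmxE unitfE det_Vandermonde; apply/prodf_neq0 => i _.
  apply/prodf_neq0 => j lt_ij.
  by rewrite !mxE subr_eq0 nth_uniq ?ltn_ord // gtn_eqF.
pose B := \sum_i \sum_j `|invmx V i j|.
have B_ge0 : 0 <= B by apply: sumr_ge0 => i _; apply: sumr_ge0.
exists (Num.bound B) => p size_p i.
have N_ge0 : 0 <= \sum_(z <- s) `|p.[z]| by apply: sumr_ge0.
have [le_ni | lt_in] := leqP n i.
  by rewrite nth_default ?normr0 ?mulr_ge0 // (leq_trans size_p).
pose r := \row_(k < n) p`_k; pose i' := Ordinal lt_in.
have rV j : (r *m V) 0 j = p.[s`_j].
  by rewrite mxE (horner_coef_wide _ size_p); apply: eq_bigr => k _; rewrite !mxE.
have -> : p`_i = (r *m V *m invmx V) 0 i' by rewrite mulmxK // mxE.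
rewrite mxE; apply: le_trans (ler_norm_sum _ _ _) _.
have le_VB j : `|invmx V j i'| <= (Num.bound B)%:R.
  apply: le_trans (ltW (archi_boundP B_ge0)).
  rewrite /B (bigD1 j) //= (bigD1 i') //= -addrA lerDl.
  by rewrite addr_ge0 ?sumr_ge0 // => k _; rewrite sumr_ge0.
rewrite (big_nth 0) big_mkord mulr_sumr; apply: ler_sum => j _.
by rewrite normrM rV mulrC ler_wpM2r.
Qed.

Lemma div_low_coef (P R : {poly int}) (t : int) : P`_0 != 0 ->
  exists (e : int) (Q R' : {poly int}),
    [/\ R = e%:P + R' * 'X + Q * P, `|e - t| <= `|P`_0|
      & (size R' <= (maxn (size R) (size P)).-1)%N].
Proof.
move=> P0; have [q [m [R0 m_ge0 m_lt]]] : exists q m : int,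
    [/\ R`_0 - t = q * P`_0 + m, 0 <= m & m < `|P`_0|].
  exists ((R`_0 - t) %/ P`_0)%Z, ((R`_0 - t) %% P`_0)%Z.
  by rewrite -divz_eq modz_ge0 ?ltz_mod.
(* [t + m] is congruent to [R_0] modulo [P_0], so [R - q P] has constant term [t + m], and [m] lies
   in [[0, |P_0|)]. *)
exists (t + m), q%:P, (drop_poly 1 (R - q%:P * P)).
split; last 1 first.
- rewrite size_drop_poly subn1 -!subn1 leq_sub2r //.
  apply: leq_trans (size_polyD _ _) _; rewrite size_polyN mul_polyC.
  by rewrite geq_max leq_maxl /= (leq_trans (size_scale_leq _ _)) ?leq_maxr.
- rewrite -[LHS](subrK (q%:P * P)) -[X in X + _ = _](poly_take_drop 1).
  congr (_ + _ + _).
  apply/polyP => i; rewrite coef_take_poly coefC coefB coefCM.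
  by case: i => [|i] //=; rewrite -[R`_0](subrK t) R0; ring.
- by rewrite addrC addKr; lia.
Qed.

(** Iterates [div_low_coef]. As [size P <= d.+1], each step keeps the size at most [d], so the
    quotient [R'] can be fed back into the same process. *)
Lemma div_low_coefs (P : {poly int}) (d k : nat) (t : nat -> int)
    (R : {poly int}) :
  P`_0 != 0 -> (size P <= d.+1)%N -> (size R <= d)%N ->
  exists E Q R' : {poly int},
    [/\ R = E + R' * 'X^k + Q * P, (size E <= k)%N, (size R' <= d)%N
      & forall i, (i < k)%N -> `|E`_i - t i| <= `|P`_0|].
Proof.
move=> P0 size_P; elim: k => [|k IHk] in t R *; move=> size_R.
  by exists 0, 0, R; split; rewrite ?size_poly0 // mul0r expr0 mulr1 addr0 add0r.
have [e [Q [R1 [defR le_e size_R1]]]] := div_low_coef R (t 0%N) P0.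
have {}size_R1 : (size R1 <= d)%N by lia.
have [E [Q1 [R2 [defR1 size_E size_R2 le_E]]]] := IHk (fun i => t i.+1) R1 size_R1.
exists (cons_poly e E), (Q + Q1 * 'X), R2; split=> //.
- by rewrite defR defR1 cons_poly_def exprSr; ring.
- by rewrite size_cons_poly; case: ifP.
- by case=> [|i] lt_ik; rewrite coef_cons //= le_E.
Qed.

Definition digit_value (a : algC) (H : nat) (z : algC) : Prop :=
  exists2 S : {poly int}, forall i, `|S`_i| <= H%:Z & z = (pZtoC S).[a].

Lemma digit_valueD (a z : algC) (H k : nat) (E : {poly int}) :
    (size E <= k)%N -> (forall i, (i < k)%N -> `|E`_i| <= H%:Z) ->
  digit_value a H z -> digit_value a H ((pZtoC E).[a] + z * a ^+ k).
Proof.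
move=> size_E le_E [S le_S ->]; exists (E + S * 'X^k).
  move=> i; rewrite coefD coefMXn; have [lt_ik | le_ki] := ltnP i k.
    by rewrite addr0 le_E.
  by rewrite nth_default ?add0r // (leq_trans size_E).
by rewrite rmorphD rmorphM /= map_polyXn !hornerE.
Qed.

Lemma digit_value_reduced (a : algC) (s : seq algC) (P : {poly int}) :
    uniq s -> a \in s -> (forall z, z \in s -> `|z| = 1) ->
    (forall z, z \in s -> root (pZtoC P) z) ->
    (size P <= (size s).+1)%N -> P`_0 != 0 ->
  exists H : nat, `|P`_0| <= H%:Z /\
    forall R : {poly int}, (size R <= size s)%N -> digit_value a H (pZtoC R).[a].
Proof.
move=> s_uniq s_a s_unit s_root size_P P0; set d := size s.
have [K coef_le] := coef_le_sum_horner s_uniq.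
(* The excess [M - 1] is the total rounding error: [d] conjugates, [d] coefficients each, error at
   most [c.+1] per coefficient. *)
set c := absz P`_0; pose M := (d * (d * c.+1)).+1.
pose N (R : {poly int}) := \sum_(z <- s) `|(pZtoC R).[z]|.
exists (M * K + c.+1)%N; split; first by lia.
have coef_leN (R : {poly int}) n i : (size R <= d)%N -> N R <= n%:R ->
    `|R`_i| <= (K * n)%:Z.
  move=> size_R leRn; have := coef_le (pZtoC R) _ i.
  rewrite size_map_inj_poly //; last exact: intr_inj.
  move=> /(_ size_R) leRi; rewrite -(ler_int algC) -[(K * n)%:~R]/((K * n)%:R).
  rewrite natrM intr_norm -coef_map.
  by apply: le_trans leRi _; apply: ler_wpM2l.
suff main n (R : {poly int}) : (size R <= d)%N -> N R <= n%:R ->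
    digit_value a (M * K + c.+1) (pZtoC R).[a].
  move=> R size_R; have N_ge0 : 0 <= N R by apply: sumr_ge0.
  by apply: (main (Num.bound (N R))); rewrite // ltW ?archi_boundP.
elim: n R => [|n IHn] R size_R leRn.
  exists R => // i; apply: le_trans (coef_leN R 0%N i size_R leRn) _; lia.
(* If the bound on [N R] is at most [M], the coefficients of [R] are at most [M * K] and [R] itself
   is the expansion. *)
have [le_nM | lt_Mn] := leqP n.+1 M.
  exists R => // i; apply: le_trans (coef_leN R n.+1 i size_R leRn) _.
  by rewrite lez_nat; nia.
pose t i := ((M%:Z * R`_i) %/ n.+1%:Z)%Z.
have [E [Q [R' [defR size_E size_R' le_Et]]]] :=
  div_low_coefs d t P0 size_P size_R.
(* The floor in [t] contributes less than [n.+1], and the distance from [E_i] to [t i] at most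
   [n.+1 * c]. *)
have le_ME i : `|M%:Z * R`_i - n.+1%:Z * E`_i| <= (n.+1 * c.+1)%:Z.
  have [lt_id | le_di] := ltnP i d; last first.
    by rewrite !nth_default ?(leq_trans size_R) ?(leq_trans size_E) ?mulr0 ?subrr.
  have /le_Et := lt_id; have := divz_eq (M%:Z * R`_i) n.+1; rewrite -/(t i).
  have := @modz_ge0 (M%:Z * R`_i) n.+1 isT; have := @ltz_pmod (M%:Z * R`_i) n.+1 isT.
  move: (_ %% _)%Z => m; rewrite -/c; move: (M%:Z * R`_i) (t i) (E`_i) => x y e.
  move=> lt_m m_ge0 -> le_ey.
  have -> : y * n.+1%:Z + m - n.+1%:Z * e = m + n.+1%:Z * (y - e) by ring.
  apply: le_trans (ler_normD _ _) _; rewrite normrM mulnS PoszD PoszM.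
  apply: lerD; first by lia.
  by rewrite ler_wpM2l // distrC (le_trans le_ey) // /c abszE.
have rootP z : z \in s ->
    (pZtoC R).[z] = (pZtoC E).[z] + (pZtoC R').[z] * z ^+ d.
  move=> /s_root/rootP Pz0.
  by rewrite defR !rmorphD !rmorphM /= map_polyXn !hornerE Pz0 mulr0 addr0.
rewrite rootP //; apply: digit_valueD => // [i lt_id|].
  have := coef_leN R n.+1 i size_R leRn; have := le_ME i.
  move: (R`_i) (E`_i) => r e le_re le_r; rewrite -(ler_pM2l (isT : 0 < n.+1%:Z)).
  rewrite -[X in X * _ <= _]ger0_norm // -normrM.
  rewrite -[X in `|X|](subrK (M%:Z * r)); apply: le_trans (ler_normD _ _) _.
  rewrite distrC normrM [`|M%:Z|]ger0_norm //.
  apply: le_trans (lerD le_re (ler_wpM2l _ le_r)) _ => //.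
  by rewrite -!PoszM -PoszD lez_nat; lia.
(* To get [N R' <= n], bound [n.+1 * |R'(z)|] at each [z] by splitting [n.+1 (R - E)] as
   [(n.+1 - M) R] plus the small polynomial [M R - n.+1 E]. *)
apply: IHn => //; rewrite -(ler_pM2l (ltr0Sn algC n)).
have le_R' z : z \in s ->
    n.+1%:R * `|(pZtoC R').[z]| <=
      (n.+1 - M)%:R * `|(pZtoC R).[z]| + (n.+1 * (d * c.+1))%:R.
  move=> sz.
  have -> : `|(pZtoC R').[z]| = `|(pZtoC R).[z] - (pZtoC E).[z]|.
    by rewrite rootP // addrAC subrr add0r normrM normrX (s_unit z) // expr1n mulr1.
  rewrite -[X in X * _ <= _]ger0_norm // -normrM.
  have -> : n.+1%:R * ((pZtoC R).[z] - (pZtoC E).[z]) =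
      (n.+1 - M)%:R * (pZtoC R).[z] + (pZtoC (M%:Z *: R - n.+1%:Z *: E)).[z].
    rewrite rmorphB /= !map_polyZ hornerD hornerN !hornerZ /= -!pmulrn natrB; last exact: ltnW.
    by ring.
  apply: le_trans (ler_normD _ _) _; rewrite normrM [`|_%:R|]ger0_norm // lerD2l.
  rewrite (@horner_coef_wide _ d); last first.
    rewrite size_map_inj_poly //; last exact: intr_inj.
    apply: leq_trans (size_polyD _ _) _; rewrite size_polyN geq_max.
    by rewrite !(leq_trans (size_scale_leq _ _)).
  apply: le_trans (ler_norm_sum _ _ _) _.
  have -> : (n.+1 * (d * c.+1))%:R = \sum_(i < d) (n.+1 * c.+1)%:R :> algC.
    by rewrite sumr_const card_ord -mulrnA; congr _%:R; lia.
  apply: ler_sum => i _; rewrite normrM normrX (s_unit z) // expr1n mulr1 coef_map /=.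
  by rewrite coefB !coefZ -intr_norm [leRHS]pmulrn ler_int le_ME.
rewrite mulr_sumr big_seq; apply: le_trans (ler_sum _ le_R') _.
rewrite -big_seq big_split /= -mulr_sumr.
apply: le_trans (lerD (ler_wpM2l _ leRn) (lexx _)) _ => //.
(* After division by [n.+1] the bound reads [n.+1 - M + d * (d * c.+1)], which is exactly [n]. *)
rewrite big_const_seq count_predT iter_addr_0 -natrM -mulrnA -natrD -natrM ler_nat.
rewrite -/d; nia.
Qed.

(** With [g] the gcd of [p] and its derivative, [a] is a root of [g] or of [p / g]. By minimality
    [p] divides that factor: the second case makes [g] constant, the first makes [p] divide its
    derivative, which is nonzero in characteristic 0 and of smaller degree. *)
Lemma separable_minCpoly (a : algC) : separable_poly (minCpoly a).
Proof.
have [p [defp p_monic p_min]] := minCpolyP a.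
rewrite defp separable_map separable_poly.unlock /coprimep.
set g := gcdp p p^`(); have [h defh] := dvdpP _ _ (dvdp_gcdl p p^`()).
have p0 : p != 0 := monic_neq0 p_monic.
have size_p : (1 < size p)%N.
  by have := size_minCpoly a; rewrite defp size_map_poly.
have h0 : h != 0 by apply: contraNneq p0 => h0; rewrite defh h0 mul0r.
have g0 : g != 0 by apply: contraNneq p0 => g0; rewrite defh -/g g0 mulr0.
have := root_minCpoly a; rewrite defp [p in root (map_poly _ p)]defh rmorphM rootM.
case/orP; rewrite p_min.
- move/(dvdp_leq h0); rewrite defh size_mul // -/g.
  have : (0 < size g)%N by rewrite lt0n size_poly_eq0.
  by move: (size g) (size h) => m n; rewrite eqn_leq; lia.
- move/dvdp_trans/(_ (dvdp_gcdr _ _)) => p_dvd.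
  have dp0 : p^`() != 0.
    apply/eqP => /(congr1 (fun q : {poly rat} => q`_(size p).-2)).
    rewrite coef_deriv coef0 prednK; last by rewrite -subn1 subn_gt0.
    by move/eqP; rewrite mulrn_eq0 -lead_coefE lead_coef_eq0 (negPf p0); lia.
  by have := dvdp_leq dp0 p_dvd; rewrite leqNgt lt_size_deriv.
Qed.

Lemma int_poly_of_minCpoly (a : algC) :
  exists (P : {poly int}) (c : algC), c != 0 /\ pZtoC P = c *: minCpoly a.
Proof.
have [p [-> _ _]] := minCpolyP a.
have [P [c c0 ->]] := rat_poly_scale p.
exists P, c%:~R; rewrite intr_eq0; split=> //.
rewrite map_polyZ /= fmorphV rmorph_int scalerA divff ?intr_eq0 // scale1r.
by rewrite -map_poly_comp; apply: eq_map_poly => i /=; rewrite rmorph_int.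
Qed.

Lemma height_reducing_digit_value (a : algC) (H : nat) :
  (forall R : {poly int}, digit_value a H (pZtoC R).[a]) -> height_reducing a.
Proof.
move=> good.
exists [set z | exists2 e : int, `|e| <= H%:Z & z = e%:~R]%classic; split.
- have := finite_image (fun n : nat => (n%:Z - H%:Z)%:~R : algC) (finite_II H.*2.+1).
  apply: sub_finite_set => _ [e le_e ->]; exists (absz (e + H%:Z)) => /=; first by lia.
  by congr _%:~R; lia.
- by move=> _ [e _ ->]; rewrite /int_set /= intr_int.
apply/seteqP; split => z [n [e [F_e ->]]]; last first.
  exists n, e; split=> // j; have [f _ ->] := F_e j; exact: intr_int.
pose p := \poly_(j < n.+1) e (inord j).
have /floorpP[q def_p] : p \is a polyOver Num.int.
  by apply/polyOver_poly => j _; apply: F_e.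
have -> : \sum_(j < n.+1) e j * a ^+ j = (pZtoC q).[a].
  by rewrite -def_p horner_poly; apply: eq_bigr => j _; rewrite inord_val.
(* Using [(size S).+1] digits pads with a zero, which covers [S = 0]: expansions must have at least
   one digit. *)
have [S le_S ->] := good q; exists (size S), (fun j => (S`_j)%:~R); split.
  by move=> j; exists S`_j.
have size_S : (size (pZtoC S) <= (size S).+1)%N.
  by rewrite (leq_trans (size_poly _ _)).
by rewrite (horner_coef_wide _ size_S); apply: eq_bigr => j _; rewrite coef_map.
Qed.

Theorem theorem2 (a : algC)
    (a_unit : forall b : algC, conjugate a b -> `|b| = 1)
    (a_rank : (degree a)%:R / 2 - 1 <= (mult_rank a)%:R :> rat
              \/ mult_rank a = 1%N) :
  height_reducing a.
Proof.
clear a_rank.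
have [s] := closed_field_poly_normal (minCpoly a).
rewrite (monicP (minCpoly_monic a)) scale1r => def_s.
have s_uniq : uniq s by rewrite -separable_prod_XsubC -def_s separable_minCpoly.
have mem_s z : (z \in s) = root (minCpoly a) z by rewrite def_s root_prod_XsubC.
have s_a : a \in s by rewrite mem_s root_minCpoly.
have s_unit z : z \in s -> `|z| = 1 by rewrite mem_s; apply: a_unit.
have [P [c [c0 def_P]]] := int_poly_of_minCpoly a.
have rootP z : root (pZtoC P) z = (z \in s) by rewrite def_P rootZ // mem_s.
have size_P : (size P <= (size s).+1)%N.
  rewrite -(size_map_inj_poly (f := intr : int -> algC)) //; last exact: intr_inj.
  by rewrite def_P size_scale // def_s size_prod_XsubC.
(* Otherwise 0 would be a conjugate of [a], yet its modulus is not 1. *)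
have P0 : P`_0 != 0.
  apply/negP => P0; have /s_unit/eqP : 0 \in s.
    by rewrite -rootP /root horner_coef0 coef_map /= (eqP P0).
  by rewrite normr0 eq_sym oner_eq0.
have [|H [le_H reduced]] := digit_value_reduced s_uniq s_a s_unit _ size_P P0.
  by move=> z; rewrite rootP.
apply: (@height_reducing_digit_value a H) => R.
have [n] := ubnP (size R); elim: n R => // n IHn R lt_Rn.
have [|lt_sR] := leqP (size R) (size s); first exact: reduced.
(* Target 0 gives a digit of size at most [|P_0| <= H]; the size drops because here
   [size P <= size R]. *)
have [e [Q [R' [defR le_e size_R']]]] := div_low_coef R 0 P0.
have /eqP Pa0 : root (pZtoC P) a by rewrite rootP.
have -> : (pZtoC R).[a] = (pZtoC e%:P).[a] + (pZtoC R').[a] * a ^+ 1.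
  by rewrite defR !rmorphD !rmorphM /= map_polyX !hornerE Pa0 mulr0 addr0.
apply: digit_valueD; first exact: size_polyC_leq1.
  by case=> // _; rewrite coefC /=; rewrite subr0 in le_e; apply: le_trans le_H.
by apply: IHn; move: size_R' size_P lt_sR lt_Rn; lia.
Qed.
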